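(* Let $n$ be a positive integer and let $h:[n]\to[n]$ be a Hessenberg function. Then there is an isomorphism of $\mathbb{C}$-algebras $$\Gamma(\mathcal{Z}(N,h)_e,\mathcal{O}_{\mathcal{Z}(N,h)_e})\;\cong\;\frac{\mathbb{C}[x_1,\ldots,x_n,\,q_{rs}\mid 2\le s\le n,\ n-h(n+1-s)<r<s]}{({}^hE_1^{(n)},\ldots,{}^hE_n^{(n)})},$$ where the left-hand side is the ring of global sections of the affine scheme $\mathcal{Z}(N,h)_e$.
   Context: Write $[n]=\{1,\ldots,n\}$. A Hessenberg function is a nondecreasing function $h:[n]\to[n]$ with $h(j)\ge j$ for all $j\in[n]$. Let $N$ be the $n\times n$ nilpotent matrix consisting of a single Jordan block ($N_{i,i+1}=1$, all other entries $0$). Let $g=(x_{ij})$ be the generic lower triangular unipotent $n\times n$ matrix: $x_{ii}=1$, $x_{ij}=0$ for $i<j$, and $x_{ij}$ ($1\le j<i\le n$) are independent variables. Set $$\mathcal{Z}(N,h)_e:=\operatorname{Spec}\,\mathbb{C}[x_{ij}\mid 1\le j<i\le n]\big/\big((g^{-1}Ng)_{ij}\mid j\in[n-1],\ h(j)<i\le n\big).$$ Let $M_n$ be the $n\times n$ matrix with diagonal entries $x_1,\ldots,x_n$, entries $-1$ in positions $(i+1,i)$, entry $q_{rs}$ in position $(r,s)$ for $1\le r<s\le n$, and zeros elsewhere. Define polynomials $E_1^{(n)},\ldots,E_n^{(n)}\in\mathbb{C}[x_1,\ldots,x_n,q_{rs}\mid 1\le r<s\le n]$ by $$\det(\lambda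 I_n-M_n)=\lambda^n-E_1^{(n)}\lambda^{n-1}+E_2^{(n)}\lambda^{n-2}+\cdots+(-1)^nE_n^{(n)}.$$ Define ${}^hE_i^{(n)}$ to be the polynomial obtained from $E_i^{(n)}$ by setting $q_{rs}=0$ for all $2\le s\le n$ and $1\le r\le n-h(n+1-s)$. *)

(* Defs.v *)
From HB Require Import structures.
From mathcomp Require Import all_boot all_order all_algebra.
From mathcomp Require Import generic_quotient ring_quotient.
From mathcomp Require Import boolp classical_sets reals.
From mathcomp Require Import complex.
From mathcomp Require Import mpoly.
From mathcomp Require Import ring.

Set Implicit Arguments.
Unset Strict Implicit.
Unset Printing Implicit Defensive.

Import GRing.Theory.

Local Open Scope ring_scope.
Local Open Scope quotient_scope.
Local Open Scope classical_set_scope.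

(* Everything is done over comPzRingType: the quotient by an arbitrary ideal,
   and the sections on a possibly empty spectrum, may be the zero ring. The ring
   instance on {ideal_quot I} needs I to be proper, so only its zmodType
   instance is reused. *)

Section QuotientRing.
Variables (A : comPzRingType) (S : set A).

Definition ideal_gen : {pred A} := fun x =>
  `[< exists m (c s : 'I_m -> A),
        (forall i, S (s i)) /\ x = \sum_(i < m) c i * s i >].

Lemma ideal_genM a x : x \in ideal_gen -> a * x \in ideal_gen.
Proof.
move=> /asboolP[m [c [s [Ss ->]]]]; apply/asboolP.
exists m, (fun i => a * c i), s; split=> //.
by rewrite mulr_sumr; apply: eq_bigr => i _; rewrite mulrA.
Qed.

Lemma ideal_genD x y :
  x \in ideal_gen -> y \in ideal_gen -> x + y \in ideal_gen.
Proof.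
move=> /asboolP[m [c [s [Ss ->]]]] /asboolP[k [d [t [St ->]]]]; apply/asboolP.
exists (m + k)%N.
exists (fun i => match split i with inl j => c j | inr j => d j end).
exists (fun i => match split i with inl j => s j | inr j => t j end).
split=> [i|]; first by case: (split i).
rewrite big_split_ord /=; congr (_ + _); apply: eq_bigr => i _.
  by rewrite (unsplitK (inl i)).
by rewrite (unsplitK (inr i)).
Qed.

Lemma ideal_gen_zmod_closed : zmod_closed ideal_gen.
Proof.
split=> [|x y Ix Iy]; last by rewrite -mulN1r; exact/ideal_genD/ideal_genM.
apply/asboolP; exists 0%N, (fun=> 0), (fun=> 0).
by split=> [[]|] //; rewrite big_ord0.
Qed.

HB.instance Definition _ :=
  GRing.isZmodClosed.Build A ideal_gen ideal_gen_zmod_closed.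

Definition quot : Type := Quotient.quot ideal_gen.

HB.instance Definition _ := GRing.Zmodule.on quot.

Definition quot_pi (a : A) : quot := \pi_(Quotient.quot ideal_gen) a.

Lemma quot_piP a b : quot_pi a = quot_pi b <-> a - b \in ideal_gen.
Proof. by rewrite Quotient.idealrBE; split=> [/eqP|/eqP]. Qed.

Lemma quot_piK (x : quot) : quot_pi (repr (x : Quotient.quot ideal_gen)) = x.
Proof. exact: reprK. Qed.

Lemma quot_pi_zmod_morphism : zmod_morphism quot_pi.
Proof. exact: (raddfB (\pi_(Quotient.quot ideal_gen))). Qed.

HB.instance Definition _ :=
  GRing.isZmodMorphism.Build A quot quot_pi quot_pi_zmod_morphism.

Let rep (x : quot) : A := repr (x : Quotient.quot ideal_gen).

Definition quot_mul (x y : quot) : quot := quot_pi (rep x * rep y).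

Lemma quot_piM a b : quot_pi (a * b) = quot_mul (quot_pi a) (quot_pi b).
Proof.
have repP c : c - rep (quot_pi c) \in ideal_gen.
  by apply/quot_piP; rewrite quot_piK.
apply/quot_piP; rewrite -[a * b](subrK (rep (quot_pi a) * b)) -addrA.
rewrite -mulrBl -mulrBr [_ * b]mulrC.
by apply: ideal_genD; exact/ideal_genM/repP.
Qed.

Lemma quot_mulA : associative quot_mul.
Proof.
move=> x y z; rewrite -[x]quot_piK -[y]quot_piK -[z]quot_piK.
by rewrite -!quot_piM mulrA.
Qed.

Lemma quot_mulC : commutative quot_mul.
Proof. by move=> x y; rewrite /quot_mul mulrC. Qed.

Lemma quot_mul1 : left_id (quot_pi 1) quot_mul.
Proof. by move=> x; rewrite -[x]quot_piK -quot_piM mul1r. Qed.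

Lemma quot_mulDl : left_distributive quot_mul +%R.
Proof.
move=> x y z; rewrite -[x]quot_piK -[y]quot_piK -[z]quot_piK.
by rewrite -raddfD -!quot_piM -raddfD mulrDl.
Qed.

HB.instance Definition _ := GRing.Zmodule_isComPzRing.Build quot
  quot_mulA quot_mulC quot_mul1 quot_mulDl.

Lemma quot_pi_monoid_morphism : monoid_morphism quot_pi.
Proof. by split=> // a b; exact: quot_piM. Qed.

HB.instance Definition _ :=
  GRing.isMonoidMorphism.Build A quot quot_pi quot_pi_monoid_morphism.

End QuotientRing.

Record spec (A : comPzRingType) := Spec {
  prime_set :> A -> Prop;
  prime0 : prime_set 0;
  primeD : forall a b, prime_set a -> prime_set b -> prime_set (a + b);
  primeMl : forall a b, prime_set b -> prime_set (a * b);
  prime1 : ~ prime_set 1;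
  primeM : forall a b, prime_set (a * b) -> prime_set a \/ prime_set b }.

Definition zariski_closed (A : comPzRingType) (Z : set (spec A)) : Prop :=
  exists T : set A, Z = [set p : spec A | T `<=` p].

Definition zariski_open (A : comPzRingType) (U : set (spec A)) : Prop :=
  zariski_closed (~` U).

Lemma zariski_openI (A : comPzRingType) (V W : set (spec A)) :
  zariski_open V -> zariski_open W -> zariski_open (V `&` W).
Proof.
move=> [S VS] [T WT].
exists [set x | exists a b, [/\ S a, T b & x = a * b]].
rewrite setCI VS WT; apply/seteqP; split=> q /=.
  move=> [Sq|Tq] _ [a [b [Sa Tb ->]]]; last exact/primeMl/Tq.
  by rewrite mulrC; exact/primeMl/Sq.
move=> STq; have [|/existsNP[a /not_implyP[Sa qa]]] := pselect (S `<=` q).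
  by left.
right=> b Tb; have : q (a * b) by apply: STq; exists a, b.
by case/primeM.
Qed.

Lemma zariski_openT (A : comPzRingType) : zariski_open [set: spec A].
Proof.
exists [set 1]; rewrite setCT; apply/seteqP; split=> // q /(_ 1 erefl).
exact: prime1.
Qed.

(* The localization of A at p: fractions a / b with b outside p. *)
Section Stalk.
Variables (A : comPzRingType) (p : spec A).

Record denom := Denom { den :> A; denP : ~ p den }.

HB.instance Definition _ := gen_eqMixin denom.
HB.instance Definition _ := gen_choiceMixin denom.

Lemma denom_mul_subproof (b c : denom) : ~ p (den b * den c).
Proof. by move=> /primeM[]; exact: denP. Qed.

Definition denom1 : denom := Denom (@prime1 A p).
Definition denomM (b c : denom) : denom := Denom (@denom_mul_subproof b c).

Definition frac_equiv : rel (A * denom) := fun x y =>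
  `[< exists u : denom, den u * (x.1 * den y.2 - y.1 * den x.2) = 0 >].

Lemma frac_equivP (x y : A * denom) :
  reflect (exists u : denom, den u * (x.1 * den y.2) = den u * (y.1 * den x.2))
          (frac_equiv x y).
Proof.
apply: (iffP (asboolP _)) => -[u Hu]; exists u.
  by apply/eqP; rewrite -subr_eq0 -mulrBr Hu.
by rewrite mulrBr Hu subrr.
Qed.

Lemma frac_equiv_is_equiv : equiv_class_of frac_equiv.
Proof.
split=> [x|x y|y x z]; first by apply/frac_equivP; exists denom1.
  by apply/frac_equivP/frac_equivP=> -[u Hu]; exists u.
move=> /frac_equivP[u Hu] /frac_equivP[v Hv]; apply/frac_equivP.
exists (denomM (denomM u v) y.2) => /=.
transitivity (den v * den z.2 * (den u * (x.1 * den y.2))); first by ring.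
rewrite Hu; transitivity (den u * den x.2 * (den v * (y.1 * den z.2))).
  by ring.
by rewrite Hv; ring.
Qed.

Canonical frac_equiv_equiv := EquivRelPack frac_equiv_is_equiv.
Canonical frac_equiv_encModRel := defaultEncModRel frac_equiv.

Definition stalk : Type := {eq_quot frac_equiv}.

HB.instance Definition _ := Choice.on stalk.

Definition frac_of (x : A * denom) : stalk := \pi_({eq_quot frac_equiv}) x.

Definition frac (a b : A) (pb : ~ p b) : stalk := frac_of (a, Denom pb).

Let rep (x : stalk) : A * denom := repr (x : {eq_quot frac_equiv}).

Lemma frac_ofP (x y : A * denom) :
  frac_of x = frac_of y <->
  exists u : denom, den u * (x.1 * den y.2) = den u * (y.1 * den x.2).
Proof.
split=> [/eqP|Hu]; first by rewrite piE => /frac_equivP.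
by apply/eqP; rewrite piE; apply/frac_equivP.
Qed.

Lemma frac_ofK (x : stalk) : frac_of (rep x) = x.
Proof. exact: reprK. Qed.

Lemma repP (x : A * denom) : exists u : denom,
  den u * ((rep (frac_of x)).1 * den x.2) =
  den u * (x.1 * den (rep (frac_of x)).2).
Proof. by apply/frac_ofP; rewrite frac_ofK. Qed.

Definition frac_add (x y : A * denom) : A * denom :=
  (x.1 * den y.2 + y.1 * den x.2, denomM x.2 y.2).
Definition frac_mul (x y : A * denom) : A * denom :=
  (x.1 * y.1, denomM x.2 y.2).
Definition frac_opp (x : A * denom) : A * denom := (- x.1, x.2).

Definition stalk_zero : stalk := frac_of (0, denom1).
Definition stalk_one : stalk := frac_of (1, denom1).
Definition stalk_add (x y : stalk) : stalk := frac_of (frac_add (rep x) (rep y)).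
Definition stalk_mul (x y : stalk) : stalk := frac_of (frac_mul (rep x) (rep y)).
Definition stalk_opp (x : stalk) : stalk := frac_of (frac_opp (rep x)).

Lemma frac_ofD x y : frac_of (frac_add x y) = stalk_add (frac_of x) (frac_of y).
Proof.
have [u Hu] := repP x; have [v Hv] := repP y.
apply/frac_ofP; exists (denomM u v); rewrite /=.
move: (rep (frac_of x)) (rep (frac_of y)) Hu Hv => x' y' Hu Hv.
transitivity (den v * den y.2 * den y'.2 * (den u * (x.1 * den x'.2)) +
              den u * den x.2 * den x'.2 * (den v * (y.1 * den y'.2))).
  by ring.
by rewrite -Hu -Hv; ring.
Qed.

Lemma frac_ofM x y : frac_of (frac_mul x y) = stalk_mul (frac_of x) (frac_of y).
Proof.
have [u Hu] := repP x; have [v Hv] := repP y.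
apply/frac_ofP; exists (denomM u v); rewrite /=.
move: (rep (frac_of x)) (rep (frac_of y)) Hu Hv => x' y' Hu Hv.
transitivity (den u * (x.1 * den x'.2) * (den v * (y.1 * den y'.2))).
  by ring.
by rewrite -Hu -Hv; ring.
Qed.

Lemma frac_ofN x : frac_of (frac_opp x) = stalk_opp (frac_of x).
Proof.
have [u Hu] := repP x; apply/frac_ofP; exists u; rewrite /=.
by rewrite !mulNr !mulrN Hu.
Qed.

Lemma stalk_addA : associative stalk_add.
Proof.
move=> x y z; rewrite -[x]frac_ofK -[y]frac_ofK -[z]frac_ofK -!frac_ofD.
by apply/frac_ofP; exists denom1; rewrite /=; ring.
Qed.

Lemma stalk_addC : commutative stalk_add.
Proof.
move=> x y; rewrite -[x]frac_ofK -[y]frac_ofK -!frac_ofD.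
by apply/frac_ofP; exists denom1; rewrite /=; ring.
Qed.

Lemma stalk_add0 : left_id stalk_zero stalk_add.
Proof.
move=> x; rewrite -[x]frac_ofK -!frac_ofD.
by apply/frac_ofP; exists denom1; rewrite /=; ring.
Qed.

Lemma stalk_addN : left_inverse stalk_zero stalk_opp stalk_add.
Proof.
move=> x; rewrite -[x]frac_ofK -frac_ofN -!frac_ofD.
by apply/frac_ofP; exists denom1; rewrite /=; ring.
Qed.

Lemma stalk_mulA : associative stalk_mul.
Proof.
move=> x y z; rewrite -[x]frac_ofK -[y]frac_ofK -[z]frac_ofK -!frac_ofM.
by apply/frac_ofP; exists denom1; rewrite /=; ring.
Qed.

Lemma stalk_mulC : commutative stalk_mul.
Proof.
move=> x y; rewrite -[x]frac_ofK -[y]frac_ofK -!frac_ofM.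
by apply/frac_ofP; exists denom1; rewrite /=; ring.
Qed.

Lemma stalk_mul1 : left_id stalk_one stalk_mul.
Proof.
move=> x; rewrite -[x]frac_ofK -!frac_ofM.
by apply/frac_ofP; exists denom1; rewrite /=; ring.
Qed.

Lemma stalk_mulDl : left_distributive stalk_mul stalk_add.
Proof.
move=> x y z; rewrite -[x]frac_ofK -[y]frac_ofK -[z]frac_ofK.
rewrite -frac_ofD -!frac_ofM -frac_ofD.
by apply/frac_ofP; exists denom1; rewrite /=; ring.
Qed.

HB.instance Definition _ := GRing.isZmodule.Build stalk
  stalk_addA stalk_addC stalk_add0 stalk_addN.
HB.instance Definition _ := GRing.Zmodule_isComPzRing.Build stalk
  stalk_mulA stalk_mulC stalk_mul1 stalk_mulDl.

Lemma fracP a b (pb : ~ p b) c d (pd : ~ p d) :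
  frac a pb = frac c pd <-> exists2 u, ~ p u & u * (a * d - c * b) = 0.
Proof.
split=> [/frac_ofP[u /= Hu]|[u pu Hu]].
  by exists (den u); [exact: denP|rewrite mulrBr Hu subrr].
apply/frac_ofP; exists (Denom pu) => /=.
by apply/eqP; rewrite -subr_eq0 -mulrBr Hu.
Qed.

Lemma frac0 : frac 0 (@prime1 A p) = 0. Proof. by []. Qed.

Lemma frac1 : frac 1 (@prime1 A p) = 1. Proof. by []. Qed.

Lemma primeC_M b c : ~ p b -> ~ p c -> ~ p (b * c).
Proof. by move=> pb pc /primeM[]. Qed.

Lemma fracD a b (pb : ~ p b) c d (pd : ~ p d) :
  frac a pb + frac c pd = frac (a * d + c * b) (primeC_M pb pd).
Proof.
rewrite /frac -[LHS]frac_ofD; by apply/frac_ofP; exists denom1; rewrite /=; ring.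
Qed.

Lemma fracM a b (pb : ~ p b) c d (pd : ~ p d) :
  frac a pb * frac c pd = frac (a * c) (primeC_M pb pd).
Proof.
rewrite /frac -[LHS]frac_ofM; by apply/frac_ofP; exists denom1; rewrite /=; ring.
Qed.

Lemma fracN a b (pb : ~ p b) : - frac a pb = frac (- a) pb.
Proof. by rewrite /frac -[LHS]frac_ofN. Qed.

End Stalk.

(* The ring of global sections of the structure sheaf of Spec A: families
   (s p)_p with s p in the localization A_p that are given by a fraction a / b
   in a Zariski neighbourhood of every point, with pointwise operations. *)
Section GlobalSections.
Variable A : comPzRingType.

Definition stalk_family : Type := forall p : spec A, stalk p.

HB.instance Definition _ := gen_eqMixin stalk_family.
HB.instance Definition _ := gen_choiceMixin stalk_family.

Section StalkFamilyRing.
Implicit Types s t : stalk_family.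

Let sf_zero : stalk_family := fun=> 0.
Let sf_one : stalk_family := fun=> 1.
Let sf_opp s : stalk_family := fun p => - s p.
Let sf_add s t : stalk_family := fun p => s p + t p.
Let sf_mul s t : stalk_family := fun p => s p * t p.

Let sf_addA : associative sf_add.
Proof. by move=> s t u; apply: functional_extensionality_dep => p; exact: addrA. Qed.
Let sf_addC : commutative sf_add.
Proof. by move=> s t; apply: functional_extensionality_dep => p; exact: addrC. Qed.
Let sf_add0 : left_id sf_zero sf_add.
Proof. by move=> s; apply: functional_extensionality_dep => p; exact: add0r. Qed.
Let sf_addN : left_inverse sf_zero sf_opp sf_add.
Proof. by move=> s; apply: functional_extensionality_dep => p; exact: addNr. Qed.
Let sf_mulA : associative sf_mul.
Proof. by move=> s t u; apply: functional_extensionality_dep => p; exact: mulrA. Qed.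
Let sf_mulC : commutative sf_mul.
Proof. by move=> s t; apply: functional_extensionality_dep => p; exact: mulrC. Qed.
Let sf_mul1 : left_id sf_one sf_mul.
Proof. by move=> s; apply: functional_extensionality_dep => p; exact: mul1r. Qed.
Let sf_mulDl : left_distributive sf_mul sf_add.
Proof. by move=> s t u; apply: functional_extensionality_dep => p; exact: mulrDl. Qed.

HB.instance Definition _ := GRing.isZmodule.Build stalk_family
  sf_addA sf_addC sf_add0 sf_addN.
HB.instance Definition _ := GRing.Zmodule_isComPzRing.Build stalk_family
  sf_mulA sf_mulC sf_mul1 sf_mulDl.

End StalkFamilyRing.

Definition locally_fraction (s : stalk_family) : Prop :=
  forall p : spec A, exists V : set (spec A), [/\ zariski_open V, V p &
    exists a b : A, forall q : spec A, V q ->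
      exists qb : ~ q b, s q = frac a qb].

Definition regular : {pred stalk_family} := fun s => `[< locally_fraction s >].

Lemma regular_cst (a : A) :
  (fun p => frac a (@prime1 A p)) \in regular.
Proof.
apply/asboolP => p; exists setT; split=> //; first exact: zariski_openT.
by exists a, 1 => q _; exists (@prime1 A q).
Qed.

Lemma regular_subring_closed : subring_closed regular.
Proof.
split=> [|s t /asboolP Rs /asboolP Rt|s t /asboolP Rs /asboolP Rt].
- exact: (regular_cst 1).
- apply/asboolP => p.
  have [V [oV Vp [a [b sE]]]] := Rs p; have [W [oW Wp [c [d tE]]]] := Rt p.
  exists (V `&` W); split=> //; first exact: zariski_openI.
  exists (a * d + (- c) * b), (b * d) => q [Vq Wq].
  have [qb sq] := sE q Vq; have [qd tq] := tE q Wq.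
  exists (primeC_M qb qd).
  by rewrite -[LHS]/(s q - t q) sq tq fracN fracD.
- apply/asboolP => p.
  have [V [oV Vp [a [b sE]]]] := Rs p; have [W [oW Wp [c [d tE]]]] := Rt p.
  exists (V `&` W); split=> //; first exact: zariski_openI.
  exists (a * c), (b * d) => q [Vq Wq].
  have [qb sq] := sE q Vq; have [qd tq] := tE q Wq.
  exists (primeC_M qb qd).
  by rewrite -[LHS]/(s q * t q) sq tq fracM.
Qed.

Definition global_sections : Type := {s : stalk_family | s \in regular}.

HB.instance Definition _ := SubChoice.on global_sections.
HB.instance Definition _ := GRing.SubChoice_isSubComPzRing.Build
  stalk_family regular global_sections regular_subring_closed.

Definition to_sections (a : A) : global_sections :=
  exist _ (fun p => frac a (@prime1 A p)) (regular_cst a).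

Lemma to_sections_zmod_morphism : zmod_morphism to_sections.
Proof.
move=> a b; apply: val_inj => /=; apply: functional_extensionality_dep => p.
rewrite -[RHS]/(frac a _ - frac b _) fracN fracD.
by apply/fracP; exists 1; [exact: prime1|ring].
Qed.

Lemma to_sections_monoid_morphism : monoid_morphism to_sections.
Proof.
split; first by apply: val_inj.
move=> a b; apply: val_inj => /=; apply: functional_extensionality_dep => p.
rewrite -[RHS]/(frac a _ * frac b _) fracM.
by apply/fracP; exists 1; [exact: prime1|ring].
Qed.

HB.instance Definition _ := GRing.isZmodMorphism.Build
  A global_sections to_sections to_sections_zmod_morphism.
HB.instance Definition _ := GRing.isMonoidMorphism.Build
  A global_sections to_sections to_sections_monoid_morphism.

End GlobalSections.

(* A commutative k-algebra is a commutative ring A with a ring morphism k -> A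
   (algType is not used because it excludes the zero ring). *)
Definition calg_iso (k A B : comPzRingType)
    (iA : {rmorphism k -> A}) (iB : {rmorphism k -> B}) : Prop :=
  exists f : {rmorphism A -> B}, bijective f /\ forall c, f (iA c) = iB c.

(* [n] is 'I_n, shifted: the 1-based index of i : 'I_n is i.+1, so a Hessenberg
   function h becomes i |-> h(i + 1) - 1, and n + 1 - s is rev_ord s. *)
Definition hessenberg n (h : 'I_n -> 'I_n) : Prop :=
  (forall i j : 'I_n, (i <= j)%N -> (h i <= h j)%N) /\
  (forall j : 'I_n, (j <= h j)%N).

Section Zscheme.
Variables (K : fieldType) (n : nat).

Definition var (V : finType) (v : V) : {mpoly K[#|V|]} := 'X_(enum_rank v).

Definition lower_idx : finType := {ij : 'I_n * 'I_n | (ij.2 < ij.1)%N}.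

Local Notation Rx := {mpoly K[#|lower_idx|]}.

Definition Nmx : 'M[Rx]_n := \matrix_(i, j) (j == i.+1 :> nat)%:R.

(* The default value 0 is only reached when i < j. *)
Definition gmx : 'M[Rx]_n :=
  \matrix_(i, j) if i == j then 1
                 else oapp (@var lower_idx) 0 (insub (i, j)).

Definition Zgens (h : 'I_n -> 'I_n) : set Rx :=
  [set f | exists i j : 'I_n, [/\ (j.+1 <= n.-1)%N, (h j < i)%N &
     f = (invmx gmx *m Nmx *m gmx) i j]].

Definition Zcoord h : comPzRingType := quot (Zgens h).

Definition Zsections h : comPzRingType := global_sections (Zcoord h).

Definition Zsections_const h : {rmorphism K -> Zsections h} :=
  to_sections (A := Zcoord h) \o (@quot_pi _ (Zgens h) \o @mpolyC #|lower_idx| K).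

Definition q_idx : finType := {rs : 'I_n * 'I_n | (rs.1 < rs.2)%N}.

Local Notation Rq := {mpoly K[#|{: 'I_n + q_idx}|]}.

(* The default value 0 is only reached when r > s + 1. *)
Definition Mmx : 'M[Rq]_n :=
  \matrix_(r, s) if r == s then var (inl r)
                 else if r == s.+1 :> nat then -1
                 else oapp (fun rs : q_idx => var (inr rs)) 0 (insub (r, s)).

(* char_poly Mmx = \det ('X - Mmx), whose coefficient of 'X^(n - i) is
   (-1)^i E_i. *)
Definition Epoly (i : nat) : Rq := (-1) ^+ i * (char_poly Mmx)`_(n - i).

(* The q_rs that are kept. Among the pairs with r < s, the excluded ones are
   exactly those with 2 <= s and r <= n - h(n + 1 - s). *)
Definition hq_idx (h : 'I_n -> 'I_n) : finType :=
  {rs : 'I_n * 'I_n |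
    (2 <= rs.2.+1)%N && (n - (h (rev_ord rs.2)).+1 < rs.1.+1 < rs.2.+1)%N}.

Definition Rh h := {mpoly K[#|{: 'I_n + hq_idx h}|]}.

Definition hsubst (h : 'I_n -> 'I_n) : #|{: 'I_n + q_idx}|.-tuple (Rh h) :=
  [tuple match enum_val k with
         | inl i => var (inl i)
         | inr rs => oapp (fun v : hq_idx h => var (inr v)) 0 (insub (val rs))
         end | k < #|{: 'I_n + q_idx}|].

Definition hEpoly h i : Rh h := Epoly i \mPo hsubst h.

Definition hEgens h : set (Rh h) :=
  [set f | exists2 i : nat, (1 <= i <= n)%N & f = hEpoly h i].

Definition hEring h : comPzRingType := quot (@hEgens h).

Definition hEring_const h : {rmorphism K -> hEring h} :=
  @quot_pi _ (@hEgens h) \o @mpolyC _ K.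

End Zscheme.

(* Main.v *)
From HB Require Import structures.
From mathcomp Require Import all_boot all_order all_algebra.
From mathcomp Require Import boolp classical_sets reals complex mpoly ring zify.
Require Import Defs.

(** The global sections of Spec A are A itself, so the statement compares two
quotients of polynomial rings, and the comparison is linear algebra.

Let g be the generic lower unitriangular matrix and A = g^-1 N g. Since N g = g A
and g is lower unitriangular, A is lower Hessenberg: ones on the superdiagonal and
zeros above it ([conj_shift_hess]). Reading N g = g A row by row shows that row
i + 1 of g is row i times A, so row i of g is e_0 A^i: the matrix g is recovered
from A as a Krylov matrix ([krylov_uniq]). Conversely, if B is lower Hessenberg
and B^n = 0, then its Krylov matrix G is lower unitriangular ([krylov_upper])
and satisfies N G = G B ([krylov_shift]). So a choice of g amounts to a choice of
a nilpotent lower Hessenberg matrix, and nilpotency is the vanishing of the lower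
coefficients of the characteristic polynomial, by Cayley-Hamilton in one direction
and similarity to N in the other.

Conjugation by the order-reversing permutation and a change of sign turn lower
Hessenberg matrices into matrices of the shape of M_n: the superdiagonal of ones
goes to the subdiagonal of -1, the entry (j, j) goes to x_r with r = n + 1 - j,
and the entry (i, j) below the diagonal goes to q_rs with r = n + 1 - i and
s = n + 1 - j. Under this dictionary, killing the entries of A with i > h(j) is
setting q_rs = 0 for r <= n - h(n + 1 - s), and the coefficients of the
characteristic polynomial are the E_i up to sign.

Accordingly there are two substitutions, [x_to_krylov] (g becomes the Krylov
matrix of -rev M) and [q_to_conj] (M becomes -rev A). Each kills the relations
of the other side ([x_to_krylov_gens], [q_to_conj_gens]), and they are mutually
inverse modulo the relations ([q_to_conjK], [x_to_krylovK]).

The map A -> O(Spec A) is bijective because an ideal missing the powers of f lies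
in a prime not containing f ([prime_avoiding]); for f = 1, an ideal contained in
no prime contains 1 ([ideal_unit]). This takes the place of compactness and
partitions of unity: in each case the elements c for which the desired statement
holds over D(c), or after multiplication by c, form an ideal. *)

Set Implicit Arguments.
Unset Strict Implicit.
Unset Printing Implicit Defensive.

Import GRing.Theory.

Local Open Scope ring_scope.
Local Open Scope classical_set_scope.

(** * Prime ideals and global sections of an affine scheme *)

Section PrimeAvoidance.
Variable A : comPzRingType.

Definition is_ideal (I : set A) : Prop :=
  [/\ I 0, forall a b, I a -> I b -> I (a + b) & forall a b, I b -> I (a * b)].

(** An ideal maximal among those containing I and missing the powers of f is
prime. Avoiding all powers of f, rather than just 1, is what gives information
on the basic open set D(f). *)
Lemma prime_avoiding (I : set A) (f : A) :
  is_ideal I -> (forall k, ~ I (f ^+ k)) ->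
  exists p : spec A, I `<=` p /\ ~ p f.
Proof.
move=> [I0 ID IM] If.
(* The maximal ideal is sought as I `|` X: then the union of the empty chain
   still gives an ideal, namely I. *)
pose P X := is_ideal (I `|` X) /\ forall k, ~ (I `|` X) (f ^+ k).
have [|X [[[X0 XD XM] Xf] maxX]] := @Zorn_bigcup A P.
  move=> F FP totF; split; last first.
    by move=> k [/If//|[X FX Xk]]; apply: ((FP X FX).2 k); right.
  split=> [|a b|a b]; first by left.
    move=> [Ia|[X FX Xa]] [Ib|[Y FY Yb]].
    - by left; apply: ID.
    - have [[_ YD _] _] := FP _ FY.
      have [] := YD a b (or_introl Ia) (or_intror Yb); first by left.
      by right; exists Y.
    - have [[_ XD _] _] := FP _ FX.
      have [] := XD a b (or_intror Xa) (or_introl Ib); first by left.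
      by right; exists X.
    - have [XY|YX] := totF _ _ FX FY.
        have [[_ YD _] _] := FP _ FY.
        have [] := YD a b (or_intror (XY _ Xa)) (or_intror Yb); first by left.
        by right; exists Y.
      have [[_ XD _] _] := FP _ FX.
      have [] := XD a b (or_intror Xa) (or_intror (YX _ Yb)); first by left.
      by right; exists X.
  move=> [Ib|[X FX Xb]]; first by left; apply: IM.
  have [[_ _ XM] _] := FP _ FX.
  by have [] := XM a b (or_intror Xb); [left|right; exists X].
set Q := I `|` X in X0 XD XM Xf.
(* By maximality, the ideal Q + (a) meets the powers of f. *)
have grow a : ~ Q a -> exists k c q, Q q /\ f ^+ k = q + c * a.
  move=> Qa; pose Y := [set x | exists c q, Q q /\ x = q + c * a].
  have QY : Q `<=` Y by move=> q Qq; exists 0, q; rewrite mul0r addr0.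
  have IYE : I `|` Y = Y.
    by apply/seteqP; split=> [x [Ix|//]|x Yx]; [apply/QY; left|right].
  apply: contrapT => noY; apply: (maxX Y).
    split; first by move=> x Xx; apply: QY; right.
    move=> /(_ a) YX; apply: Qa; right; apply: YX.
    by exists 1, 0; split=> //; rewrite mul1r add0r.
  rewrite /P IYE; split; last first.
    by move=> k [c [q [Qq E]]]; apply: noY; exists k, c, q.
  split; first exact: QY.
    move=> _ _ [c [q [Qq ->]]] [d [r [Qr ->]]].
    exists (c + d), (q + r); split; [exact: XD|by ring].
  move=> b _ [c [q [Qq ->]]].
  exists (b * c), (b * q); split; [exact: XM|by ring].
have Q1 : ~ Q 1 by exact: (Xf 0%N).
have Qprime a b : Q (a * b) -> Q a \/ Q b.
  move=> Qab.
  have [Qa|/grow[k [c [q [Qq Ek]]]]] := pselect (Q a); first by left.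
  have [Qb|/grow[l [d [r [Qr El]]]]] := pselect (Q b); first by right.
  exfalso; apply: (Xf (k + l)%N); rewrite exprD Ek El.
  have -> : (q + c * a) * (r + d * b) =
            (r + d * b) * q + ((c * a) * r + (c * d) * (a * b)) by ring.
  by apply: (XD); [exact: XM|apply: (XD); exact: (XM)].
exists (Spec X0 XD XM Q1 Qprime); split; first by move=> x Ix; left.
exact: (Xf 1%N).
Qed.

Lemma ideal_unit (I : set A) :
  is_ideal I -> (forall p : spec A, ~ I `<=` p) -> I 1.
Proof.
move=> iI np; apply: contrapT => I1.
by have [|p [/np]] := @prime_avoiding I 1 iI; [move=> k; rewrite expr1n|].
Qed.

Lemma prime_pow (p : spec A) a k : ~ p a -> ~ p (a ^+ k).
Proof.
move=> pa; elim: k => [|k IH]; first exact: prime1.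
by rewrite exprS; exact: primeC_M.
Qed.

Lemma zariski_open_basic (V : set (spec A)) (p : spec A) :
  zariski_open V -> V p ->
  exists g : A, ~ p g /\ forall q : spec A, ~ q g -> V q.
Proof.
move=> [T VT] Vp.
have : ~ (~` V) p by move=> /(_ Vp).
rewrite VT /= => /existsNP[g /not_implyP[Tg pg]].
exists g; split=> // q qg; apply: contrapT => nVq.
by have : (~` V) q by []; rewrite VT => /(_ _ Tg).
Qed.

End PrimeAvoidance.

Section AffineSections.
Variable A : comPzRingType.
Implicit Types (p q : spec A) (a b c f g : A) (s t : stalk_family A).

Definition germ (p : spec A) (a : A) : stalk p := frac a (@prime1 A p).

Lemma germ_eq0 p a : germ p a = 0 <-> exists2 u, ~ p u & u * a = 0.
Proof.
rewrite -(frac0 p) fracP; split=> -[u pu Hu]; exists u => //.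
  by rewrite -{}Hu; ring.
by rewrite mulr1 mul0r subr0.
Qed.

Lemma germB p a b : germ p (a - b) = germ p a - germ p b.
Proof.
by rewrite /germ fracN fracD; apply/fracP; exists 1; [exact: prime1|ring].
Qed.

Lemma germD p a b : germ p (a + b) = germ p a + germ p b.
Proof. by rewrite /germ fracD; apply/fracP; exists 1; [exact: prime1|ring]. Qed.

Lemma germM p a b : germ p (a * b) = germ p a * germ p b.
Proof. by rewrite /germ fracM; apply/fracP; exists 1; [exact: prime1|ring]. Qed.

(** Elements outside p are units of the stalk at p. *)
Lemma germ_mulI0 p g (x : stalk p) : ~ p g -> germ p g * x = 0 -> x = 0.
Proof.
move=> pg; have gV : frac 1 pg * germ p g = 1.
  by rewrite /germ fracM -frac1; apply/fracP; exists 1; [exact: prime1|ring].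
by move=> gx; rewrite -[x]mul1r -gV -mulrA gx mulr0.
Qed.

Lemma germ_frac p a b (pb : ~ p b) : germ p b * frac a pb = germ p a.
Proof.
by rewrite /germ fracM; apply/fracP; exists 1; [exact: prime1|ring].
Qed.

(** An element vanishing on D(f) is zero in A_f: its annihilator is an ideal that
no prime outside V(f) contains, so it contains a power of f. *)
Lemma germ_eq0_basic f a :
  (forall p, ~ p f -> germ p a = 0) -> exists k, f ^+ k * a = 0.
Proof.
move=> fa0; apply: contrapT => nk.
have [||p [Ip pf]] := @prime_avoiding A [set x | x * a = 0] f.
- split=> [|b c /= b0 c0|b c /= c0]; first exact: mul0r.
    by rewrite mulrDl b0 c0 addr0.
  by rewrite -mulrA c0 mulr0.
- by move=> k /= fk; apply: nk; exists k.
by have /germ_eq0[u pu /Ip] := fa0 p pf.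
Qed.

(** The same for sections. They are only locally fractions, so the exponent k
depends on the neighbourhood; the elements c such that one exponent works on all
of D(c) form an ideal, and the local exponents put it in no prime. *)
Lemma section_eq0_basic f t :
  t \in @regular A -> (forall p, ~ p f -> t p = 0) ->
  exists k, forall p, germ p (f ^+ k) * t p = 0.
Proof.
move=> /asboolP tR ft0.
pose J := [set c | exists k, forall p, ~ p c -> germ p (f ^+ k) * t p = 0].
have up k l p : germ p (f ^+ k) * t p = 0 -> germ p (f ^+ (l + k)) * t p = 0.
  by move=> E; rewrite exprD germM -mulrA E mulr0.
suff [k Jk] : J 1 by exists k => p; apply: Jk; exact: prime1.
apply: ideal_unit; first split.
- by exists 0%N => p /(_ (prime0 p)).
- move=> c d [k ck] [l dl]; exists (k + l)%N => p pcd.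
  have [pc|/ck/(up _ l)] := pselect (p c); last by rewrite addnC.
  have [pd|/dl/(up _ k)//] := pselect (p d).
  by case: pcd; exact: primeD.
- move=> b c [k ck]; exists k => p pbc.
  by apply: ck => pc; apply: pbc; exact: primeMl.
move=> q Jq; have [V [oV Vq [a [b tE]]]] := tR q.
have [g [qg gV]] := zariski_open_basic oV Vq.
have [|k gfk] := @germ_eq0_basic (g * f) a.
  move=> p pgf.
  have pg : ~ p g by move=> pg; apply: pgf; rewrite mulrC; exact: primeMl.
  have pf : ~ p f by move=> pf; apply: pgf; exact: primeMl.
  have [pb E] := tE p (gV _ pg).
  by rewrite -(germ_frac a pb) -E ft0 // mulr0.
apply: qg; apply: Jq; exists k => p pg.
have [pb ->] := tE p (gV _ pg).
apply: (germ_mulI0 pb); rewrite mulrCA germ_frac.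
apply: (germ_mulI0 (prime_pow (k := k) pg)).
rewrite mulrA -!germM -exprMn gfk.
by apply/germ_eq0; exists 1; [exact: prime1|rewrite mul1r].
Qed.

Lemma to_sections_inj : injective (@to_sections A).
Proof.
move=> a b ab; apply/eqP; rewrite -subr_eq0; apply/eqP.
have [p _|k] := @germ_eq0_basic 1 (a - b); last by rewrite expr1n mul1r.
have /(congr1 (fun s : global_sections A => val s p)) := ab.
by rewrite /= germB -/(germ p a) => ->; rewrite subrr.
Qed.

(** The elements c for which c s comes from A form an ideal. Near a prime q the
section s is a / b on some D(g); then b s - a vanishes on D(g), so a power of g
makes g^k b s = g^k a hold everywhere, and g^k b is a member outside q. *)
Lemma to_sections_surj (s : global_sections A) : exists a, to_sections a = s.
Proof.
pose I := [set c | exists a, forall p, germ p c * val s p = germ p a].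
suff [a aE] : I 1.
  exists a; apply: val_inj => /=; apply: functional_extensionality_dep => p.
  by rewrite -/(germ p a) -aE /germ frac1 mul1r.
apply: ideal_unit; first split.
- by exists 0 => p; rewrite /germ frac0 mul0r.
- by move=> c d [a aE] [b bE]; exists (a + b) => p; rewrite !germD mulrDl aE bE.
- by move=> b c [a aE]; exists (b * a) => p; rewrite !germM -mulrA aE.
move=> q Iq; have /asboolP/(_ q)[V [oV Vq [a [b sE]]]] := valP s.
have [g [qg gV]] := zariski_open_basic oV Vq.
have [||k kE] := @section_eq0_basic g (val (to_sections b * s - to_sections a)).
- exact: valP.
- move=> p pg; rewrite -[LHS]/(germ p b * val s p - germ p a).
  by have [pb ->] := sE p (gV _ pg); rewrite germ_frac subrr.
have qgb : ~ q (g ^+ k * b).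
  by apply: primeC_M; [exact: prime_pow|have [] := sE q Vq].
apply: qgb; apply: Iq; exists (g ^+ k * a) => p; apply/eqP.
rewrite -subr_eq0 !germM -mulrA -mulrBr; apply/eqP; exact: kE.
Qed.

Lemma to_sections_bij : bijective (@to_sections A).
Proof.
have [r rE] := choice to_sections_surj.
by exists r => // a; apply: to_sections_inj; rewrite rE.
Qed.

End AffineSections.

(** * Morphisms out of quotients and polynomial rings *)

Section QuotientMorphism.
Variables (A B : comPzRingType) (S : set A) (T : set B).
Variable F : {rmorphism A -> B}.

(** The proof that F respects the relations is an argument, so that the ring
morphism structure declared below can be found from the term alone. *)
Definition quot_map of (forall a, S a -> quot_pi T (F a) = 0) :
    quot S -> quot T :=
  fun x => quot_pi T (F (repr (x : Quotient.quot (ideal_gen S)))).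

Hypothesis FS : forall a, S a -> quot_pi T (F a) = 0.

Lemma quot_mapE a : quot_map FS (quot_pi S a) = quot_pi T (F a).
Proof.
rewrite /quot_map; set r := repr _.
have : quot_pi S r = quot_pi S a by exact: quot_piK.
move/quot_piP/asboolP => [m [c [s [Ss rE]]]].
suff : quot_pi T (F (r - a)) = 0 by rewrite !rmorphB => /subr0_eq.
rewrite rE (rmorph_sum F) (rmorph_sum (quot_pi T)) big1 // => i _.
by rewrite !rmorphM /= (FS (Ss i)) mulr0.
Qed.

Lemma quot_map_zmod_morphism : zmod_morphism (quot_map FS).
Proof.
move=> x y; rewrite -[x]quot_piK -[y]quot_piK -raddfB !quot_mapE.
by rewrite !raddfB.
Qed.

Lemma quot_map_monoid_morphism : monoid_morphism (quot_map FS).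
Proof.
split; first by rewrite -(rmorph1 (quot_pi S)) quot_mapE !rmorph1.
move=> x y; rewrite -[x]quot_piK -[y]quot_piK -rmorphM !quot_mapE.
by rewrite !rmorphM.
Qed.

HB.instance Definition _ := GRing.isZmodMorphism.Build _ _
  (quot_map FS) quot_map_zmod_morphism.
HB.instance Definition _ := GRing.isMonoidMorphism.Build _ _
  (quot_map FS) quot_map_monoid_morphism.

End QuotientMorphism.

Lemma quot_gen0 (A : comPzRingType) (S : set A) a : S a -> quot_pi S a = 0.
Proof.
move=> Sa; rewrite -(raddf0 (quot_pi S)); apply/quot_piP/asboolP.
exists 1%N, (fun=> 1), (fun=> a); split=> //.
by rewrite big_ord1 subr0 mul1r.
Qed.

Section Substitution.
Variables (K : fieldType) (V W : finType).

Definition subst_var (F : V -> {mpoly K[#|W|]}) :=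
  comp_mpoly [tuple F (enum_val k) | k < #|V|].

HB.instance Definition _ F := GRing.RMorphism.on (subst_var F).

Lemma subst_varE F v : subst_var F (var K v) = F v.
Proof.
by rewrite /subst_var comp_mpolyXU -tnth_nth tnth_mktuple enum_rankK.
Qed.

Lemma subst_varC F c : subst_var F c%:MP = c%:MP.
Proof. exact: comp_mpolyC. Qed.

Lemma mpoly_rmorph_eq (B : pzRingType)
    (f g : {rmorphism {mpoly K[#|V|]} -> B}) :
  (forall c, f c%:MP = g c%:MP) -> (forall v, f (var K v) = g (var K v)) ->
  f =1 g.
Proof.
move=> fgC fgX p; rewrite [p]mpolyE !rmorph_sum; apply: eq_bigr => m _.
rewrite -mul_mpolyC !rmorphM fgC mpolyXE_id !rmorph_prod; congr (_ * _).
by apply: eq_bigr => i _; rewrite !rmorphXn -(enum_valK i) fgX.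
Qed.

End Substitution.

Lemma calg_iso_of_bij (k A B : comPzRingType) (iA : {rmorphism k -> A})
    (iB : {rmorphism k -> B}) (f : {rmorphism B -> A}) :
  bijective f -> (forall c, f (iB c) = iA c) -> calg_iso iA iB.
Proof.
move=> [g fK gK] fi.
pose gZ := GRing.isZmodMorphism.Build _ _ g (can2_zmod_morphism fK gK).
pose gM := GRing.isMonoidMorphism.Build _ _ g (can2_monoid_morphism fK gK).
pose g' : {rmorphism A -> B} := HB.pack g gZ gM.
exists g'; split; first by exists f.
by move=> c; rewrite -fi; exact: fK.
Qed.

(** * Characteristic polynomials and cyclic vectors *)

Section RevMatrix.
Variables (R : comPzRingType) (n : nat).
Implicit Types M : 'M[R]_n.

Definition rev_mx M : 'M[R]_n := \matrix_(i, j) M (rev_ord i) (rev_ord j).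

Lemma rev_mxM M M' : rev_mx (M *m M') = rev_mx M *m rev_mx M'.
Proof.
apply/matrixP => i j; rewrite !mxE (reindex_inj rev_ord_inj).
by apply: eq_bigr => k _; rewrite !mxE.
Qed.

Lemma rev_mx1 : rev_mx 1%:M = 1%:M.
Proof. by apply/matrixP => i j; rewrite !mxE (inj_eq rev_ord_inj). Qed.

Lemma rev_mxX M k : rev_mx (M ^+ k) = rev_mx M ^+ k.
Proof.
elim: k => [|k IH]; first exact: rev_mx1.
by rewrite !exprS -IH; exact: rev_mxM.
Qed.

End RevMatrix.

Section CharPoly.
Variables (R : comNzRingType) (n : nat).

Lemma char_poly_conj (P Q M : 'M[R]_n) :
  Q *m P = 1%:M -> char_poly (Q *m M *m P) = char_poly M.
Proof.
move=> QP; have {1}-> : char_poly (Q *m M *m P) =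
    \det (map_mx polyC Q *m char_poly_mx M *m map_mx polyC P).
  rewrite /char_poly /char_poly_mx; congr (\det _).
  rewrite !map_mxM mulmxBr mulmxBl; congr (_ - _).
  by rewrite scalar_mxC -mulmxA -map_mxM QP map_mx1 mulmx1.
by rewrite !det_mulmx mulrAC -det_mulmx -map_mxM QP map_mx1 det1 mul1r.
Qed.

Lemma char_poly_strict_trig (M : 'M[R]_n) :
  (forall i j : 'I_n, (i <= j)%N -> M i j = 0) -> char_poly M = 'X^n.
Proof.
move=> M0; rewrite char_poly_trig.
  under eq_bigr => i _ do rewrite M0 // subr0.
  by rewrite prodr_const card_ord.
by apply/is_trig_mxP => i j ij; rewrite M0 // ltnW.
Qed.

End CharPoly.

(** Cayley-Hamilton is applied before f, since B may be the zero ring, where the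
theorem is not available. *)
Lemma Cayley_Hamilton_nilpotent (R : comNzRingType) (B : comPzRingType) n
  (f : {rmorphism R -> B}) (M : 'M[R]_n.+1) :
  (forall i, (i <= n)%N -> f (char_poly M)`_i = 0) ->
  map_mx f M ^+ n.+1 = 0.
Proof.
move=> f0.
have : map_mx f (horner_mx M (char_poly M)) = 0.
  by rewrite Cayley_Hamilton map_mx0.
rewrite /horner_mx /horner_morph horner_coef.
rewrite size_map_poly_id0; last first.
  by rewrite (monicP (char_poly_monic M)) oner_eq0.
rewrite size_char_poly big_ord_recr /= raddfD raddf_sum /= big1 ?add0r.
  rewrite coef_map /=.
  have := monicP (char_poly_monic M).
  rewrite lead_coefE size_char_poly /= => ->.
  by rewrite mul1r rmorphXn.
move=> i _; rewrite coef_map /= map_mxM map_scalar_mx f0; last by rewrite -ltnS.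
by rewrite mul_scalar_mx scale0r.
Qed.

Section Krylov.
Variables (R : comPzRingType) (m : nat).
Local Notation n := m.+1.

Definition lower_hess (B : 'M[R]_n) : Prop :=
  forall i j : 'I_n, (i < j)%N -> B i j = (j == i.+1 :> nat)%:R.

Definition shift_mx : 'M[R]_n := \matrix_(i, j) (j == i.+1 :> nat)%:R.

(** The rows are e_0, e_0 B, e_0 B^2, and so on: the orbit of the first basis
row vector. *)
Definition krylov (B : 'M[R]_n) : 'M[R]_n := \matrix_(i, j) (B ^+ i) ord0 j.

Lemma shift_mxE (G : 'M[R]_n) (i k : 'I_n) (j : 'I_n) :
  k = i.+1 :> nat -> (shift_mx *m G) i j = G k j.
Proof.
move=> ki; rewrite mxE (bigD1 k) //= mxE ki eqxx mul1r big1 ?addr0 // => l lk.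
by rewrite mxE -ki (inj_eq val_inj) (negbTE lk) mul0r.
Qed.

Lemma shift_mx_last (G : 'M[R]_n) (i j : 'I_n) :
  i.+1 = n -> (shift_mx *m G) i j = 0.
Proof.
move=> im; rewrite mxE big1 // => k _; rewrite mxE im.
by rewrite ltn_eqF ?mul0r.
Qed.

(** Multiplication by B moves the last nonzero coordinate of a row vector one
step to the right, with coefficient 1. *)
Lemma krylov_upper (B : 'M[R]_n) (i j : 'I_n) : lower_hess B -> (i <= j)%N ->
  krylov B i j = (i == j)%:R.
Proof.
move=> hB; rewrite mxE -val_eqE /=; case: i => i /= _.
elim: i j => [|i IH] j ij; first by rewrite expr0 mxE.
rewrite exprSr mxE.
have hi : (i < n)%N by apply: leq_trans (ltn_ord j); rewrite ltnS ltnW.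
rewrite (bigD1 (Ordinal hi)) //= IH ?leqnn //= eqxx mul1r hB //= eq_sym.
rewrite big1 ?addr0 // => k ki.
have [ik|kj] := leqP i k.
  rewrite IH //; case: eqP => [E|]; last by rewrite mul0r.
  by case/eqP: ki; apply: val_inj.
rewrite hB ?(ltn_trans kj) //.
by rewrite gtn_eqF ?mulr0 // (leq_trans _ ij).
Qed.

(** Row i of both sides is e_0 B^(i + 1); for the last row the shift gives 0,
which is where nilpotency enters. *)
Lemma krylov_shift (B : 'M[R]_n) :
  B ^+ n = 0 -> shift_mx *m krylov B = krylov B *m B.
Proof.
move=> Bn; apply/matrixP => i j.
have -> : (krylov B *m B) i j = (B ^+ i.+1) ord0 j.
  by rewrite exprSr !mxE; apply: eq_bigr => k _; rewrite mxE.
have [im|im] := eqVneq i.+1 n; first by rewrite shift_mx_last // im Bn mxE.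
have hi : (i.+1 < n)%N by rewrite ltn_neqAle im ltn_ord.
by rewrite (shift_mxE _ (k := Ordinal hi)) // mxE.
Qed.

(** Row i + 1 of G is row i of the shifted matrix, hence row i of G times B. *)
Lemma krylov_uniq (B G : 'M[R]_n) :
  (forall j, G ord0 j = (ord0 == j)%:R) ->
  shift_mx *m G = G *m B -> G = krylov B.
Proof.
move=> G0 NG; apply/matrixP => i j; rewrite mxE.
case: i => i; elim: i j => [|i IH] j hi.
  by rewrite expr0 mxE -G0; congr (G _ _); apply: val_inj.
rewrite exprSr mxE -(shift_mxE _ (i := Ordinal (ltnW hi))) // NG mxE.
by apply: eq_bigr => k _; rewrite IH.
Qed.

(** Entry (i, j) of N G = G B expresses B i j as G (i + 1) j minus a combination
of the B l j with l < i, which vanish by induction because j > l + 1. *)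
Lemma conj_shift_hess (G B : 'M[R]_n) :
  (forall i j : 'I_n, (i <= j)%N -> G i j = (i == j)%:R) ->
  shift_mx *m G = G *m B -> lower_hess B.
Proof.
move=> Gu NG.
suff H k (i j : 'I_n) :
    (i <= k)%N -> (i < j)%N -> B i j = (j == i.+1 :> nat)%:R.
  by move=> i j; exact: (H i).
elim: k i j => [|k IH] i j ik ij.
all: have hi : (i.+1 < n)%N by apply: leq_ltn_trans ij (ltn_ord j).
all: have := congr1 (fun M : 'M[R]_n => M i j) NG.
all: rewrite (shift_mxE _ (k := Ordinal hi)) // Gu //.
all: rewrite mxE (bigD1 i) //= Gu ?leqnn // eqxx mul1r big1 ?addr0.
all: try by rewrite -val_eqE eq_sym => /esym ->.
all: move=> l li; have [il|li'] := leqP i l;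
  first by rewrite Gu // eq_sym (negbTE li) mul0r.
- by move: li'; rewrite (leqn0 i) in ik; rewrite (eqP ik).
- rewrite IH ?(ltn_trans li') //; last by rewrite -ltnS (leq_trans li').
  by rewrite gtn_eqF ?mulr0 // (leq_trans _ ij).
Qed.

End Krylov.

Lemma map_shift_mx (R B : comPzRingType) (f : {rmorphism R -> B}) m :
  map_mx f (shift_mx R m) = shift_mx B m.
Proof. by apply/matrixP => i j; rewrite !mxE rmorph_nat. Qed.

Lemma map_krylov (R B : comPzRingType) (f : {rmorphism R -> B}) m
  (M : 'M[R]_m.+1) : map_mx f (krylov M) = krylov (map_mx f M).
Proof. by apply/matrixP => i j; rewrite !mxE -rmorphXn mxE. Qed.

(** N G = G M determines M from G, so this identifies the image of M under f as
soon as the image of G is known. *)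
Lemma conj_shift_uniq (R B : comPzRingType) (f : {rmorphism R -> B}) m
    (G G' M : 'M[R]_m.+1) (C : 'M[B]_m.+1) :
  G' *m G = 1%:M -> shift_mx R m *m G = G *m M ->
  shift_mx B m *m map_mx f G = map_mx f G *m C -> map_mx f M = C.
Proof.
move=> GV GM GC; rewrite -[LHS]mul1mx -[RHS]mul1mx.
have <- : map_mx f G' *m map_mx f G = 1%:M by rewrite -map_mxM GV map_mx1.
rewrite -!mulmxA; congr (_ *m _).
by rewrite -GC -map_mxM -GM map_mxM map_shift_mx.
Qed.

(** * The two substitutions *)

Section Comparison.
Variables (K : fieldType) (m : nat).
Local Notation n := m.+1.
Variable h : 'I_n -> 'I_n.
Hypothesis hh : hessenberg h.

Local Notation Rx := {mpoly K[#|lower_idx n|]}.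
Local Notation Rq := {mpoly K[#|{: 'I_n + q_idx n}|]}.
Local Notation piZ := (quot_pi (@Zgens K n h)).
Local Notation piE := (quot_pi (@hEgens K n h)).

Definition conjN : 'M[Rx]_n := invmx (gmx K n) *m Nmx K n *m gmx K n.

(** The matrix position (r, s) of the variable x_r or q_rs. *)
Definition pos (P : pred ('I_n * 'I_n)) (v : 'I_n + {rs | P rs}) :
    'I_n * 'I_n :=
  match v with inl r => (r, r) | inr rs => val rs end.

Lemma hsubst_var (v : 'I_n + q_idx n) : var K v \mPo hsubst K h =
  match v with
  | inl i => var K (inl i)
  | inr rs => oapp (fun u : hq_idx h => var K (inr u)) 0 (insub (val rs))
  end.
Proof. exact: (subst_varE (fun v : 'I_n + q_idx n => match v with
  | inl i => var K (inl i)
  | inr rs => oapp (fun u : hq_idx h => var K (inr u)) 0 (insub (val rs))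
  end)). Qed.

Definition hessM : 'M[Rh K h]_n := map_mx (comp_mpoly (hsubst K h)) (Mmx K n).

(** The lower Hessenberg matrix to which M corresponds, and which takes the place
of g^-1 N g over the ring of the variables x_r and q_rs. *)
Definition revM : 'M[Rh K h]_n := - rev_mx hessM.

Lemma NmxE : Nmx K n = shift_mx _ _. Proof. by []. Qed.

Lemma gmx_upper (i j : 'I_n) : (i <= j)%N -> gmx K n i j = (i == j)%:R.
Proof.
move=> ij; rewrite mxE; case: eqP => // _.
by rewrite insubN //= -leqNgt.
Qed.

Lemma gmx_unit : gmx K n \in unitmx.
Proof.
rewrite unitmxE det_trig.
  by rewrite big1 ?unitr1 // => i _; rewrite gmx_upper ?eqxx.
apply/is_trig_mxP => i j ij; rewrite gmx_upper ?(ltnW ij) //.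
by rewrite -val_eqE /= ltn_eqF.
Qed.

Lemma gmx_shift : shift_mx _ _ *m gmx K n = gmx K n *m conjN.
Proof. by rewrite /conjN -mulmxA mulKVmx ?gmx_unit // NmxE. Qed.

Lemma conjN_hess : lower_hess conjN.
Proof. exact: conj_shift_hess gmx_upper gmx_shift. Qed.

Lemma gmx_krylov : gmx K n = krylov conjN.
Proof. by apply: krylov_uniq gmx_shift => j; rewrite gmx_upper. Qed.

Lemma conjN_gen (i j : 'I_n) : (h j < i)%N -> piZ (conjN i j) = 0.
Proof.
move=> hji; apply: quot_gen0; exists i, j; split=> //.
by have := ltn_ord i; have := hh.2 j; move: hji => /=; lia.
Qed.

(** -rev(g^-1 N g) is similar to -rev N, which is strictly lower triangular. *)
Lemma char_poly_rev_conjN : char_poly (- rev_mx conjN) = 'X^n.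
Proof.
rewrite /conjN !rev_mxM -mulNmx -mulmxN char_poly_conj; last first.
  by rewrite -rev_mxM mulVmx ?gmx_unit // rev_mx1.
apply: char_poly_strict_trig => i j ij; rewrite !mxE /=.
by case: eqP => [|_]; rewrite ?oppr0 //; lia.
Qed.

Lemma hessME (r s : 'I_n) : hessM r s =
  if r == s then var K (inl r)
  else if r == s.+1 :> nat then -1
  else oapp (fun v : hq_idx h => var K (inr v)) 0 (insub (r, s)).
Proof.
rewrite !mxE; case: eqP => [rs|nrs]; first exact: hsubst_var.
case: ifP => _; first by rewrite rmorphN1.
case: (insubP (q_idx n)) => [v _ vE|/= nrs'] /=.
  by rewrite -vE hsubst_var.
by rewrite raddf0 insubN //=; lia.
Qed.

Lemma hessM_pos (v : 'I_n + hq_idx h) : hessM (pos v).1 (pos v).2 = var K v.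
Proof.
case: v => [r|rs]; rewrite hessME ?eqxx //=.
have /and3P[_ _ rs12] := valP rs.
rewrite -val_eqE /= ltn_eqF // ltn_eqF; last exact: ltnW.
by rewrite -surjective_pairing valK.
Qed.

Lemma revME (i j : 'I_n) : revM i j = - hessM (rev_ord i) (rev_ord j).
Proof. by rewrite /revM /rev_mx !mxE. Qed.

Lemma revM_hess : lower_hess revM.
Proof.
move=> i j ij; have in_ := ltn_ord i; have jn := ltn_ord j.
rewrite revME hessME.
case: eqP => [/rev_ord_inj ij_eq|_]; first by rewrite ij_eq ltnn in ij.
have -> : (rev_ord i == (rev_ord j).+1 :> nat) = (j == i.+1 :> nat).
  by rewrite /=; lia.
case: ifP => _; first by rewrite opprK.
by rewrite insubN ?oppr0 //=; lia.
Qed.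

(** The dictionary between the two vanishing conditions: at position (i, j),
with r = rev i and s = rev j, the condition i > h(j) says that q_rs is not among
the variables kept. *)
Lemma revM_eq0 (i j : 'I_n) : (h j < i)%N -> revM i j = 0.
Proof.
move=> hji; have in_ := ltn_ord i; have jn := ltn_ord j; have jh := hh.2 j.
rewrite revME hessME.
case: eqP => [/rev_ord_inj ij_eq|_]; first by move: hji; rewrite ij_eq; lia.
rewrite ifF; last by rewrite /=; lia.
by rewrite insubN ?oppr0 //= rev_ordK; lia.
Qed.

Lemma char_poly_hessM k : (k < n)%N -> piE (char_poly hessM)`_k = 0.
Proof.
move=> kn; rewrite -map_char_poly coef_map /=.
pose i := (n - k)%N; have ki : k = (n - i)%N by rewrite /i; lia.
have : piE (hEpoly K h i) = 0.
  by apply: quot_gen0; exists i => //; rewrite /i; lia.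
rewrite /hEpoly /Epoly !rmorphM /= !rmorphXn /= !rmorphN1 -ki => E0.
by rewrite -[LHS]mul1r -(sqrr_sign _ i) expr2 -mulrA E0 mulr0.
Qed.

Lemma revM_nilpotent : map_mx piE revM ^+ n = 0.
Proof.
rewrite -rmorphXn /= /revM exprNn -rev_mxX rmorphM /=.
suff -> : map_mx piE (rev_mx (hessM ^+ n)) = 0 by rewrite mulr0.
have : map_mx piE (hessM ^+ n) = 0.
  rewrite rmorphXn /=; apply: Cayley_Hamilton_nilpotent => k kn.
  exact: char_poly_hessM.
move=> E; apply/matrixP => i j.
by have /matrixP/(_ (rev_ord i) (rev_ord j)) := E; rewrite !mxE.
Qed.

Definition x_to_krylov : {rmorphism Rx -> Rh K h} :=
  subst_var (fun ij : lower_idx n => krylov revM (val ij).1 (val ij).2).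

Lemma x_to_krylov_gmx : map_mx x_to_krylov (gmx K n) = krylov revM.
Proof.
apply/matrixP => i j; rewrite mxE; have [ij|ji] := leqP i j.
  by rewrite gmx_upper // krylov_upper ?rmorph_nat //; exact: revM_hess.
rewrite mxE; case: eqP => [ij|_]; first by rewrite ij ltnn in ji.
by rewrite insubT /= subst_varE.
Qed.

(** The image of g is the Krylov matrix of revM, and modulo the E_i revM is
nilpotent, so the image of g^-1 N g is revM. *)
Lemma x_to_krylov_conjN : map_mx (piE \o x_to_krylov) conjN = map_mx piE revM.
Proof.
apply: conj_shift_uniq (mulVmx gmx_unit) gmx_shift _.
have -> : map_mx (piE \o x_to_krylov) (gmx K n) = krylov (map_mx piE revM).
  by rewrite map_mx_comp x_to_krylov_gmx map_krylov.
exact: krylov_shift revM_nilpotent.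
Qed.

Lemma x_to_krylov_gens f : Zgens h f -> piE (x_to_krylov f) = 0.
Proof.
move=> [i [j [_ hji ->]]].
have /matrixP/(_ i j) := x_to_krylov_conjN; rewrite mxE /= => ->.
by rewrite mxE revM_eq0 // raddf0.
Qed.

Definition q_to_conj : {rmorphism Rh K h -> Rx} :=
  subst_var (fun v : 'I_n + hq_idx h => (- rev_mx conjN) (pos v).1 (pos v).2).

(** The same substitution on all the variables q_rs. It sends M_n to -rev(g^-1 N g)
exactly, and therefore kills the unrestricted E_i; [q_to_conj] agrees with it
modulo the relations of the scheme. *)
Definition qall_to_conj : {rmorphism Rq -> Rx} :=
  subst_var (fun v : 'I_n + q_idx n => (- rev_mx conjN) (pos v).1 (pos v).2).

Lemma q_to_conj_var (v : 'I_n + hq_idx h) :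
  q_to_conj (var K v) = (- rev_mx conjN) (pos v).1 (pos v).2.
Proof.
exact: (subst_varE (fun v : 'I_n + hq_idx h => (- rev_mx conjN) _ _)).
Qed.

Lemma qall_to_conj_var (v : 'I_n + q_idx n) :
  qall_to_conj (var K v) = (- rev_mx conjN) (pos v).1 (pos v).2.
Proof. exact: (subst_varE (fun v : 'I_n + q_idx n => (- rev_mx conjN) _ _)). Qed.

Lemma rev_conjNE (i j : 'I_n) :
  (- rev_mx conjN) i j = - conjN (rev_ord i) (rev_ord j).
Proof. by rewrite /rev_mx !mxE. Qed.

Lemma qall_to_conj_Mmx : map_mx qall_to_conj (Mmx K n) = - rev_mx conjN.
Proof.
apply/matrixP => r s; have rn := ltn_ord r; have sn := ltn_ord s.
rewrite mxE [Mmx _ _ _ _]mxE.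
case: eqP => [<-|nrs]; first by rewrite qall_to_conj_var.
have {}nrs : r != s :> nat by apply/eqP => E; apply: nrs; apply: ord_inj.
case: (insubP (q_idx n)) => [v /= rs vE|/= nrs'] /=.
  by rewrite ltn_eqF ?qall_to_conj_var /= ?vE // ltnW.
rewrite rev_conjNE conjN_hess /=; last lia.
case: eqP => rs1; first by rewrite rmorphN1 (_ : (_ == _) = true) //; lia.
by rewrite raddf0 (_ : (_ == _) = false) ?oppr0 //; lia.
Qed.

(** A variable q_rs set to 0 by h goes, under [qall_to_conj], to an entry of
g^-1 N g that is a relation of the scheme. *)
Lemma q_to_conj_hsubst p :
  piZ (q_to_conj (p \mPo hsubst K h)) = piZ (qall_to_conj p).
Proof.
apply: (@mpoly_rmorph_eq K _ _ (piZ \o (q_to_conj \o comp_mpoly (hsubst K h)))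
  (piZ \o qall_to_conj)) => [c|[r|rs]] /=.
- by rewrite comp_mpolyC !subst_varC.
- by rewrite hsubst_var q_to_conj_var qall_to_conj_var.
- rewrite hsubst_var qall_to_conj_var /=.
  case: (insubP (hq_idx h)) => [v _ vE|/= nkept] /=.
    by rewrite q_to_conj_var /= vE.
  rewrite rev_conjNE raddf0 raddfN /= conjN_gen ?raddf0 ?oppr0 //.
  move: nkept (valP rs) => /=.
  have := ltn_ord (val rs).1; have := ltn_ord (val rs).2; lia.
Qed.

Lemma q_to_conj_gens f : hEgens f -> piZ (q_to_conj f) = 0.
Proof.
move=> [i /andP[i0 ni] ->]; rewrite q_to_conj_hsubst /Epoly rmorphM /=.
rewrite -coef_map map_char_poly qall_to_conj_Mmx char_poly_rev_conjN coefXn.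
by rewrite (_ : (_ == _) = false) ?mulr0 ?raddf0 //; lia.
Qed.

Lemma q_to_conj_hessM :
  map_mx (piZ \o q_to_conj) hessM = map_mx piZ (- rev_mx conjN).
Proof.
rewrite -qall_to_conj_Mmx; apply/matrixP => r s.
by rewrite !mxE /=; exact: q_to_conj_hsubst.
Qed.

Lemma q_to_conj_revM : map_mx (piZ \o q_to_conj) revM = map_mx piZ conjN.
Proof.
apply/matrixP => i j; rewrite [LHS]mxE revME rmorphN /=.
have /matrixP/(_ (rev_ord i) (rev_ord j)) := q_to_conj_hessM.
rewrite [LHS]mxE /= => ->.
by rewrite [X in - X]mxE rev_conjNE !rev_ordK rmorphN opprK [RHS]mxE.
Qed.

Lemma q_to_conjK a : piZ (q_to_conj (x_to_krylov a)) = piZ a.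
Proof.
apply: (@mpoly_rmorph_eq K _ _ (piZ \o (q_to_conj \o x_to_krylov)) piZ)
  => [c|ij] /=.
  by rewrite !subst_varC.
have -> : x_to_krylov (var K ij) = krylov revM (val ij).1 (val ij).2.
  exact: (subst_varE (fun ij : lower_idx n => krylov revM _ _)).
have -> : var K ij = gmx K n (val ij).1 (val ij).2.
  rewrite mxE -surjective_pairing valK /=.
  by rewrite -val_eqE gtn_eqF // (valP ij).
have := map_krylov (piZ \o q_to_conj) revM.
rewrite q_to_conj_revM -map_krylov -gmx_krylov.
by move/matrixP/(_ (val ij).1 (val ij).2); rewrite [LHS]mxE [RHS]mxE.
Qed.

Lemma x_to_krylovK a : piE (x_to_krylov (q_to_conj a)) = piE a.
Proof.
apply: (@mpoly_rmorph_eq K _ _ (piE \o (x_to_krylov \o q_to_conj)) piE)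
  => [c|v] /=.
  by rewrite !subst_varC.
rewrite q_to_conj_var rev_conjNE !raddfN /=.
have /matrixP/(_ (rev_ord (pos v).1) (rev_ord (pos v).2)) := x_to_krylov_conjN.
rewrite [LHS]mxE [RHS]mxE revME !rev_ordK hessM_pos /= => ->.
by rewrite raddfN opprK.
Qed.

Lemma quot_q_to_conjK :
  cancel (quot_map q_to_conj_gens) (quot_map x_to_krylov_gens).
Proof. by move=> x; rewrite -[x]quot_piK !quot_mapE x_to_krylovK. Qed.

Lemma quot_x_to_krylovK :
  cancel (quot_map x_to_krylov_gens) (quot_map q_to_conj_gens).
Proof. by move=> x; rewrite -[x]quot_piK !quot_mapE q_to_conjK. Qed.

Lemma Zsections_iso : calg_iso (Zsections_const K h) (hEring_const K h).
Proof.
apply: (@calg_iso_of_bij K _ _ (Zsections_const K h) (hEring_const K h)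
  (@to_sections (Zcoord K h) \o quot_map q_to_conj_gens)) => [|c] /=.
  apply: bij_comp (@to_sections_bij _) _.
  exists (quot_map x_to_krylov_gens); first exact: quot_q_to_conjK.
  exact: quot_x_to_krylovK.
rewrite quot_mapE; congr (to_sections (quot_pi _ _)); exact: subst_varC.
Qed.

End Comparison.

Theorem theorem1p1 (R : realType) (n : nat) (h : 'I_n -> 'I_n) :
  (0 < n)%N -> hessenberg h ->
  calg_iso (Zsections_const R[i] h) (hEring_const R[i] h).
Proof. by case: n h => [//|m] h _; exact: Zsections_iso. Qed.
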